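(* Let $0<\rho<1$. Regarding $\pi_K$ (for $K\in\mathbb N$) as a probability measure on $\mathbb N^2$, $\pi_K$ converges weakly to $\pi$ as $K$ goes to infinity.
   Context: $\mathbb N=\{0,1,2,\dots\}$. $\pi_K$: symmetric finite-capacity join-the-shortest-queue model. Two one-server queues of capacity $K$, exponential service times with parameter $1$, Poisson arrivals with parameter $2\rho$ joining the shortest queue (either queue with probability $1/2$ in case of equality), lost when both queues have length $K$. The queue-length process is the irreducible continuous-time Markov chain on $\{0,\dots,K\}^2$ with rates: from $(k,k)$, to $(k+1,k)$ and $(k,k+1)$ at rate $\rho$ each if $k<K$, and to $(k-1,k)$ and $(k,k-1)$ at rate $1$ each if $k>0$; from $(j,k)$ with $j<k$, to $(j+1,k)$ at rate $2\rho$, to $(j-1,k)$ at rate $1$ if $j>0$, to $(j,k-1)$ at rate $1$; symmetrically from $(k,j)$ with $j<k$, to $(k,j+1)$ at rate $2\rho$, to $(k,j-1)$ at rate $1$ if $j>0$, to $(k-1,j)$ at rate $1$. $\pi_K$ is its unique invariant probability distribution, extended by $0$ outside $\{0,\dots,K\}^2$. $\pi$: the same model with infinite capacities, i.e. the Markov chain on $\mathbb N^2$ with the same rates with no restriction $k<K$ (no customer is lost). For $\rho<1$ it is ergodic and $\pi$ is its unique invariant probability distribution. *)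

(* Defs.v *)
From HB Require Import structures.
From mathcomp Require Import all_boot all_order all_algebra.
From mathcomp Require Import all_classical all_reals all_analysis.

Set Implicit Arguments.
Unset Strict Implicit.
Unset Printing Implicit Defensive.

Import Order.TTheory GRing.Theory Num.Theory.
Import numFieldNormedType.Exports.

Local Open Scope classical_set_scope.
Local Open Scope ring_scope.

(* Off-diagonal transition rates x -> y of the two-queue process.  An arrival
   at a queue of length n is admitted when [room n]; a customer joining the
   strictly shorter of two queues always finds room there. *)
Definition jsq_rate (R : realType) (rho : R) (room : pred nat)
    (x y : nat * nat) : R :=
  let: (i, j) := x in
  if i == j then
    if room i && ((y == (i.+1, j)) || (y == (i, j.+1))) then rho
    else if (0 < i)%N && ((y == (i.-1, j)) || (y == (i, j.-1))) then 1
    else 0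
  else if (i < j)%N then
    if y == (i.+1, j) then 2 * rho
    else if (0 < i)%N && (y == (i.-1, j)) then 1
    else if y == (i, j.-1) then 1
    else 0
  else
    if y == (i, j.+1) then 2 * rho
    else if (0 < j)%N && (y == (i, j.-1)) then 1
    else if y == (i.-1, j) then 1
    else 0.

(* Invariant probability distribution, extended by 0 outside E, of the
   continuous-time Markov chain on the countable state space E with
   off-diagonal rates q: pi Q = 0, the diagonal term -q(y) pi(y), with
   q(y) = \sum_z q(y, z), being moved to the left-hand side. *)
Definition invariant_probability (R : realType) (E : set (nat * nat))
    (q : nat * nat -> nat * nat -> R)
    (P : probability (nat * nat)%type R) : Prop :=
  P (~` E) = 0%E /\
  forall y, E y ->
    (P [set y] * (\esum_(z in E) (q y z)%:E) =
     \esum_(x in E) (P [set x] * (q x y)%:E))%E.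

Definition box (K : nat) : set (nat * nat) :=
  [set x | (x.1 <= K)%N /\ (x.2 <= K)%N].

Definition jsq_finite_invariant (R : realType) (rho : R) (K : nat)
    (P : probability (nat * nat)%type R) : Prop :=
  invariant_probability (box K) (jsq_rate rho (fun n => (n < K)%N)) P.

Definition jsq_infinite_invariant (R : realType) (rho : R)
    (P : probability (nat * nat)%type R) : Prop :=
  invariant_probability setT (jsq_rate rho xpredT) P.

(* The topology on nat * nat is the product of the discrete ones. *)
Definition weakly_converges (R : realType)
    (P_ : nat -> probability (nat * nat)%type R)
    (P : probability (nat * nat)%type R) : Prop :=
  forall f : nat * nat -> R, continuous f -> bounded_fun f ->
    (\int[P_ n]_x f x) @[n --> \oo] --> \int[P]_x f x.

(* Main.v *)
Require Import Defs.
From HB Require Import structures.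
From mathcomp Require Import all_boot all_order all_algebra.
From mathcomp Require Import all_classical all_reals all_analysis.
From mathcomp Require Import ring lra zify.

(* Put d = pi_K - pi.  Both laws satisfy the balance equations of the infinite
   chain, up to a defect of pi_K of total mass at most E = 8 pi_K(K, K) carried
   by the blocked arrivals at the corner.  The positive part d^+ is then
   subinvariant up to the defect, and as mass is conserved the total excess is
   at most E; hence the inflow of d^+ at each state is at most its outflow
   plus E, and the same follows for d^-.  One of d^+, d^- vanishes at the empty
   state; going up from there along departures (of rate 1) bounds that part at
   every state x by C_x E.  The drift of i^2 + j^2 gives
   E_{pi_K}[i + j] <= 2 / (1 - rho) uniformly in K, so that the laws pi_K are
   tight and E tends to 0.  Tightness upgrades the one-sided pointwise bound to
   convergence in total variation. *)

Set Implicit Arguments.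
Unset Strict Implicit.
Unset Printing Implicit Defensive.

Import Order.TTheory GRing.Theory Num.Theory.
Import numFieldNormedType.Exports.

Local Open Scope classical_set_scope.
Local Open Scope ring_scope.

Arguments jsq_rate : simpl never.

Local Notation below K := (fun n => (n < K)%N).

(** * Excess inflow of the positive and negative parts *)

(* [s] has to contain the predecessors of [s'] for [d] to be balanced up to [e];
   summing the excess over [s'] only loses outgoing mass, whence the bound. *)
Lemma inflow_posr_part_le (R : realDomainType) (T : eqType)
    (s' s : seq T) (q : T -> T -> R) (w d : T -> R) :
  {subset s' <= s} -> uniq s' -> uniq s ->
  (forall x y, 0 <= q x y) ->
  (forall x, \sum_(z <- s') q x z <= w x) ->
  (forall x, x \in s -> x \notin s' -> d x <= 0) ->
  let e z := d z * w z - \sum_(y <- s) d y * q y z in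
  forall x, x \in s' ->
  \sum_(y <- s) Num.max (d y) 0 * q y x + `|e x| <=
    Num.max (d x) 0 * w x + \sum_(z <- s') `|e z|.
Proof.
move=> ss' us' us q0 qw d0 e x xs'.
pose a y := Num.max (d y) 0.
have a0 y : 0 <= a y by rewrite /a le_max lexx orbT.
have da y : d y <= a y by rewrite /a le_max lexx.
(* The excess at [z] of inflow of [a] plus [|e z|] over outflow. It is nonnegative: where [d z <= 0]
   the outflow vanishes; elsewhere [a z = d z], and the inflow of [d] is at most that of [a]. *)
pose r z := \sum_(y <- s) a y * q y z + `|e z| - a z * w z.
have r0 z : 0 <= r z.
  rewrite /r subr_ge0 {1}/a; case: (leP (d z) 0) => dz.
    by rewrite mul0r addr_ge0// sumr_ge0// => y _; rewrite mulr_ge0.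
  have -> : d z * w z = \sum_(y <- s) d y * q y z + e z by rewrite /e; ring.
  by rewrite lerD ?ler_norm// ler_sum// => y _; rewrite ler_wpM2r.
(* States of [s] outside [s'] carry no positive part, and every other state sends at rate at most
   [w] into [s']. So the excesses sum to at most the total of [|e z|], which then bounds each of
   them. *)
have flow : \sum_(z <- s') \sum_(y <- s) a y * q y z <=
    \sum_(z <- s') a z * w z.
  rewrite exchange_big/= (bigID [in s'])/= [X in _ + X]big1_seq ?addr0; last first.
    move=> y /andP[ys' ys].
    by rewrite -mulr_sumr /a max_r ?mul0r// d0.
  rewrite -big_filter (perm_big s'); last first.
    rewrite uniq_perm ?filter_uniq// => y.
    by rewrite mem_filter andb_idr//; exact: ss'.
  by apply: ler_sum => y _; rewrite -mulr_sumr ler_wpM2l.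
have : r x <= \sum_(z <- s') r z.
  by rewrite (bigD1_seq x)//= lerDl sumr_ge0.
rewrite /r sumrB big_split/= -/(a x); move: flow.
under [X in _ -> _ -> X + _ <= _]eq_bigr do rewrite -/(a _).
by lra.
Qed.

(** Symmetry does not apply, as [d <= 0] outside [s'] is one-sided. Instead d^- = d^+ - d: the
    balance of [d] with its defect is subtracted from the bound for d^+, where the term [|e x|] kept
    on the left absorbs [e x]. *)
Lemma inflow_negr_part_le (R : realDomainType) (T : eqType)
    (s' s : seq T) (q : T -> T -> R) (w d : T -> R) :
  {subset s' <= s} -> uniq s' -> uniq s ->
  (forall x y, 0 <= q x y) ->
  (forall x, \sum_(z <- s') q x z <= w x) ->
  (forall x, x \in s -> x \notin s' -> d x <= 0) ->
  let e z := d z * w z - \sum_(y <- s) d y * q y z in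
  forall x, x \in s' ->
  \sum_(y <- s) Num.max (- d y) 0 * q y x <=
    Num.max (- d x) 0 * w x + \sum_(z <- s') `|e z|.
Proof.
move=> ss' us' us q0 qw d0 e x xs'.
have := inflow_posr_part_le ss' us' us q0 qw d0 xs'.
rewrite -/(e x); under [X in _ + _ <= _ + X -> _]eq_bigr do rewrite -/(e _).
have maxN y : Num.max (- d y) 0 = Num.max (d y) 0 - d y.
  by case: (leP (d y) 0) => dy; case: leP => ?; lra.
rewrite maxN mulrBl; under [X in _ -> X <= _]eq_bigr do rewrite maxN mulrBl.
rewrite sumrB; have := ler_norm (e x); rewrite {1}/e.
by lra.
Qed.

(** * Finite boxes of states *)

Definition boxseq (n : nat) : seq (nat * nat) :=
  [seq (i, j) | i <- iota 0 n.+1, j <- iota 0 n.+1].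

Lemma boxseq_uniq n : uniq (boxseq n).
Proof. by apply: allpairs_uniq; rewrite ?iota_uniq// => -[? ?] [? ?]. Qed.

Lemma mem_boxseq n x : (x \in boxseq n) = (x.1 <= n)%N && (x.2 <= n)%N.
Proof.
have memI m : (m \in iota 0 n.+1) = (m <= n)%N by rewrite mem_iota add0n ltnS.
apply/allpairsP/idP => [[p [p1 p2 ->]]|/andP[x1 x2]]; first by rewrite -!memI p1.
by exists x; rewrite !memI x1 x2; case: x {x1 x2}.
Qed.

Lemma boxseq_sub m n : (m <= n)%N -> {subset boxseq m <= boxseq n}.
Proof. by move=> mn x; rewrite !mem_boxseq; lia. Qed.

Local Ltac decide_nat_tests := repeat match goal with
  | |- context[@eq_op _ ?m ?n] =>
    let H := fresh in
    ((have H : (m == n) = false by lia) || (have H : (m == n) = true by lia));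
    rewrite H {H}
  | |- context[leq ?m ?n] =>
    let H := fresh in
    ((have H : (leq m n) = false by lia) || (have H : (leq m n) = true by lia));
    rewrite H {H}
  end.

(** * The rates as a sum of four jumps *)

Section explicit_rates.
Variables (R : realType) (rho : R).
Implicit Type room : pred nat.

Definition arrival1 room (x : nat * nat) : R :=
  if x.1 == x.2 then rho * (room x.1)%:R
  else if (x.1 < x.2)%N then 2 * rho else 0.

Definition arrival2 room (x : nat * nat) : R :=
  if x.1 == x.2 then rho * (room x.1)%:R
  else if (x.1 < x.2)%N then 0 else 2 * rho.

(** The successive tests in [jsq_rate] are mutually exclusive. In additive form, a sum over [y]
    reduces to evaluations at four targets. *)
Lemma jsq_rateE room x y : jsq_rate rho room x y =
  arrival1 room x * (y == (x.1.+1, x.2))%:R +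
  arrival2 room x * (y == (x.1, x.2.+1))%:R +
  (0 < x.1)%:R * (y == (x.1.-1, x.2))%:R + (0 < x.2)%:R * (y == (x.1, x.2.-1))%:R.
Proof.
case: x y => i j [a b]; rewrite /jsq_rate /arrival1 /arrival2 /= !xpair_eqE.
case: (ltngtP i j) => ij.
(* Each coordinate of [y] is compared with the three values reachable by a jump; empty queues are
   split off later because [0.-1] is [0]. *)
all: (have [?|?] := eqVneq a i.+1;
  [|have [?|?] := eqVneq a i; [|have [?|?] := eqVneq a i.-1]]).
all: (have [?|?] := eqVneq b j.+1;
  [|have [?|?] := eqVneq b j; [|have [?|?] := eqVneq b j.-1]]).
all: (have [?|?] := posnP i); have [?|?] := posnP j.
all: try lia.
all: decide_nat_tests.
all: rewrite /= ?andbF ?andbT ?mulr1 ?mulr0 ?mul1r ?addr0 ?add0r //.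
all: case: (room i); rewrite /= ?mulr1 ?mulr0 //.
Qed.
End explicit_rates.

Lemma sumr_delta (R : pzSemiRingType) (T : eqType) (s : seq T) (t : T) (F : T -> R) :
  uniq s -> \sum_(z <- s) (z == t)%:R * F z = (t \in s)%:R * F t.
Proof.
move=> us; case: (boolP (t \in s)) => ts.
  rewrite (bigD1_seq t)//= eqxx big1 ?addr0// => z /negPf ->.
  by rewrite mul0r.
rewrite mul0r big1_seq// => z /andP[_ zs].
by case: eqP zs ts => [-> ->//|]; rewrite mul0r.
Qed.

(** * Exit rates and sums of rates over boxes *)

Section rate_sums.
Variables (R : realType) (rho : R).
Hypotheses (rho0 : 0 < rho) (rho1 : rho < 1).
Implicit Type room : pred nat.

Definition jsq_out room (x : nat * nat) : R :=
  arrival1 rho room x + arrival2 rho room x + (0 < x.1)%:R + (0 < x.2)%:R.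

Lemma arrival1_ge0 room x : 0 <= arrival1 rho room x.
Proof.
by rewrite /arrival1; case: ifP => _; [|case: ifP => _ //]; rewrite mulr_ge0// ltW.
Qed.

Lemma arrival2_ge0 room x : 0 <= arrival2 rho room x.
Proof.
by rewrite /arrival2; case: ifP => _; [|case: ifP => _ //]; rewrite mulr_ge0// ltW.
Qed.

Lemma jsq_rate_ge0 room x y : 0 <= jsq_rate rho room x y.
Proof.
rewrite jsq_rateE; have [u1 u2] := (arrival1_ge0 room x, arrival2_ge0 room x).
by rewrite !addr_ge0// mulr_ge0.
Qed.

(** Taking [F] constant gives exit rates; taking increments of [sqnorm] gives the generator applied
    to [sqnorm]. *)
Lemma sum_jsq_rate room (s : seq (nat * nat)) x (F : nat * nat -> R) : uniq s ->
  \sum_(z <- s) jsq_rate rho room x z * F z =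
  arrival1 rho room x * (((x.1.+1, x.2) \in s)%:R * F (x.1.+1, x.2)) +
  arrival2 rho room x * (((x.1, x.2.+1) \in s)%:R * F (x.1, x.2.+1)) +
  (0 < x.1)%:R * (((x.1.-1, x.2) \in s)%:R * F (x.1.-1, x.2)) +
  (0 < x.2)%:R * (((x.1, x.2.-1) \in s)%:R * F (x.1, x.2.-1)).
Proof.
move=> us; under eq_bigr do rewrite jsq_rateE !mulrDl -!mulrA.
by rewrite !big_split/= -!mulr_sumr !sumr_delta.
Qed.

(** No jump leaves the box: on the diagonal the capacity test blocks arrivals at the corner, and off
    it the shorter queue has length below [K]. The membership factors therefore drop out. *)
Lemma sum_jsq_rate_finite K x (F : nat * nat -> R) : x \in boxseq K ->
  \sum_(z <- boxseq K) jsq_rate rho (below K) x z * F z =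
  arrival1 rho (below K) x * F (x.1.+1, x.2) +
  arrival2 rho (below K) x * F (x.1, x.2.+1) +
  (0 < x.1)%:R * F (x.1.-1, x.2) + (0 < x.2)%:R * F (x.1, x.2.-1).
Proof.
rewrite mem_boxseq => /andP[x1 x2]; rewrite sum_jsq_rate ?boxseq_uniq//.
rewrite !mem_boxseq/= x1 x2 !andbT /= !(leq_trans (leq_pred _))// /= !mul1r.
congr (_ + _ + _ + _); rewrite !mulrA; congr (_ * _).
  rewrite /arrival1; case: eqVneq => [|_].
    by case: (x.1 < K)%N; rewrite ?mulr1 ?mulr0.
  by case: ltnP => h; rewrite ?mul0r// (leq_trans h)// mulr1.
rewrite /arrival2; case: eqVneq => [<-|].
  by case: (x.1 < K)%N; rewrite ?mulr1 ?mulr0.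
rewrite neq_ltn; case: ltnP => h; rewrite ?mul0r//= => h'.
by rewrite (leq_trans h')// mulr1.
Qed.

Lemma sum_jsq_rate_interior room n x (F : nat * nat -> R) : x \in boxseq n ->
  \sum_(z <- boxseq n.+1) jsq_rate rho room x z * F z =
  arrival1 rho room x * F (x.1.+1, x.2) + arrival2 rho room x * F (x.1, x.2.+1) +
  (0 < x.1)%:R * F (x.1.-1, x.2) + (0 < x.2)%:R * F (x.1, x.2.-1).
Proof.
rewrite mem_boxseq => /andP[x1 x2]; rewrite sum_jsq_rate ?boxseq_uniq//.
have x1' : (x.1 <= n.+1)%N by apply: leqW.
have x2' : (x.2 <= n.+1)%N by apply: leqW.
by rewrite !mem_boxseq/= x1' x2' !ltnS x1 x2 !(leq_trans (leq_pred _))// /= !mul1r.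
Qed.

Lemma sum_jsq_rate_le_out room s x : uniq s ->
  \sum_(z <- s) jsq_rate rho room x z <= jsq_out room x.
Proof.
move=> us; have := sum_jsq_rate room x (fun=> 1) us.
under eq_bigr do rewrite mulr1.
move=> ->; rewrite /jsq_out !mulr1.
by rewrite !lerD// ler_piMr// ?arrival1_ge0 ?arrival2_ge0// lern1 leq_b1.
Qed.

Lemma jsq_out_le4 room x : jsq_out room x <= 4.
Proof.
have b1 (b : bool) : b%:R <= 1 :> R by rewrite lern1 leq_b1.
have rr : rho * (room x.1)%:R <= rho by rewrite ler_piMr// ltW.
have uv : arrival1 rho room x + arrival2 rho room x <= 2 * rho.
  rewrite /arrival1 /arrival2; case: ifP => _; first lra.
  by case: ifP => _; lra.
have [x1 x2] := (b1 (0 < x.1)%N, b1 (0 < x.2)%N).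
rewrite /jsq_out; apply: le_trans (lerD (lerD uv x1) x2) _; move: rho1; lra.
Qed.

Lemma sum_jsq_rate_finite_out K x : x \in boxseq K ->
  \sum_(z <- boxseq K) jsq_rate rho (below K) x z = jsq_out (below K) x.
Proof.
move=> xK; have := sum_jsq_rate_finite (fun=> 1) xK.
by under eq_bigr do rewrite mulr1; rewrite !mulr1.
Qed.

Lemma sum_jsq_rate_interior_out room n x : x \in boxseq n ->
  \sum_(z <- boxseq n.+1) jsq_rate rho room x z = jsq_out room x.
Proof.
move=> xK; have := sum_jsq_rate_interior room (fun=> 1) xK.
by under eq_bigr do rewrite mulr1; rewrite !mulr1.
Qed.

(** The rates into the box already add up to [jsq_out], which still bounds their sum when [y] is
    adjoined to the box. *)
Lemma jsq_rate_finite_closed K x y : x \in boxseq K -> y \notin boxseq K ->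
  jsq_rate rho (below K) x y = 0.
Proof.
move=> xK yK; have := sum_jsq_rate_finite_out xK.
have := sum_jsq_rate_le_out (below K) (s := y :: boxseq K) x.
rewrite cons_uniq yK boxseq_uniq big_cons => /(_ isT) + h; rewrite h gerDr => le0.
by apply/eqP; rewrite eq_le le0 jsq_rate_ge0.
Qed.

Lemma arrival1_finite_le K x : arrival1 rho (below K) x <= arrival1 rho xpredT x.
Proof.
rewrite /arrival1; case: ifP => // _; rewrite ler_wpM2l ?(ltW rho0)// ler_nat.
exact: leq_b1.
Qed.

Lemma arrival2_finite_le K x : arrival2 rho (below K) x <= arrival2 rho xpredT x.
Proof.
rewrite /arrival2; case: ifP => // _; rewrite ler_wpM2l ?(ltW rho0)// ler_nat.
exact: leq_b1.
Qed.

Lemma jsq_rate_finite_le K x y :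
  jsq_rate rho (below K) x y <= jsq_rate rho xpredT x y.
Proof.
by rewrite !jsq_rateE !lerD// ler_wpM2r// ?arrival1_finite_le ?arrival2_finite_le.
Qed.

Lemma jsq_out_finite_le K x : jsq_out (below K) x <= jsq_out xpredT x.
Proof. by rewrite !lerD// ?arrival1_finite_le ?arrival2_finite_le. Qed.

(** Capacity is tested only on the diagonal, and within the box the test fails only at the
    corner. *)
Lemma arrival_finite_eq K x : x \in boxseq K -> x != (K, K) ->
  (arrival1 rho (below K) x = arrival1 rho xpredT x) *
  (arrival2 rho (below K) x = arrival2 rho xpredT x).
Proof.
rewrite mem_boxseq /arrival1 /arrival2; case: x => i j /= /andP[iK jK].
rewrite xpair_eqE; case: (eqVneq i j) => [<-|]//; rewrite andbb => iK'.
by have -> : (i < K)%N by rewrite ltn_neqAle iK' iK.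
Qed.

Lemma jsq_rate_finite_eq K x y : x \in boxseq K -> x != (K, K) ->
  jsq_rate rho (below K) x y = jsq_rate rho xpredT x y.
Proof. by move=> xK xKK; rewrite !jsq_rateE !(arrival_finite_eq xK xKK). Qed.

Lemma jsq_out_finite_eq K x : x \in boxseq K -> x != (K, K) ->
  jsq_out (below K) x = jsq_out xpredT x.
Proof. by move=> xK xKK; rewrite /jsq_out !(arrival_finite_eq xK xKK). Qed.

End rate_sums.

(** * Propagation along departures, Lyapunov drift, defect of balance *)

Section drift.
Variables (R : realType) (rho : R).
Hypotheses (rho0 : 0 < rho) (rho1 : rho < 1).

(* Exit rates are at most 4, so that [g y <= 4 * g x + E] along a departure
   [y -> x]; the powers of 5 absorb the additive [E]. *)
Lemma departure_propagation (g : nat * nat -> R) (E : R) n :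
  0 <= E -> (forall x, 0 <= g x) -> g (0, 0)%N = 0 ->
  (forall x, x \in boxseq n ->
    \sum_(y <- boxseq n.+1) g y * jsq_rate rho xpredT y x <=
      g x * jsq_out rho xpredT x + E) ->
  forall x, x \in boxseq n -> g x <= 5 ^+ (x.1 + x.2) * E.
Proof.
move=> E0 g0 g00 gE.
have step x y : x \in boxseq n -> y \in boxseq n ->
    jsq_rate rho xpredT y x >= 1 -> g y <= 4 * g x + E.
  move=> xn yn yx.
  apply: (@le_trans _ _ (g x * jsq_out rho xpredT x + E)); last first.
    by rewrite lerD2r mulrC ler_wpM2r// jsq_out_le4.
  apply: le_trans (gE _ xn).
  rewrite (bigD1_seq y) ?boxseq_uniq//=; last exact: boxseq_sub yn.
  rewrite (le_trans (ler_peMr _ yx))// lerDl sumr_ge0// => z _.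
  by rewrite mulr_ge0// jsq_rate_ge0.
move=> [i j]; move: {2}(i + j)%N (erefl (i + j)%N) => m; rewrite /=.
elim: m => [|m IH] in i j *.
  by move=> /eqP; rewrite addn_eq0 => /andP[/eqP -> /eqP ->] _; rewrite g00 mulr_ge0.
move=> ijm ijn; have main x : x \in boxseq n -> (x.1 + x.2 = m)%N ->
    jsq_rate rho xpredT (i, j) x >= 1 -> g (i, j) <= 5 ^+ (i + j) * E.
  case: x => a b xn abm /(step _ _ xn ijn) /le_trans; apply.
  have := IH a b abm xn; rewrite abm ijm exprS => h.
  have : E <= 5 ^+ m * E by rewrite ler_peMl// exprn_ege1// ler1n.
  by move: h; lra.
have rate a b c d : 0 <= a -> 0 <= b -> 0 <= c -> 0 <= d ->
   (1 <= c) || (1 <= d) -> 1 <= a + b + c + d :> R.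
  by move=> ? ? ? ? /orP[] ?; lra.
(* The departure is taken from the second queue if it is nonempty, otherwise from the first; either
   lowers the total length by one. *)
have [j0|j0] := posnP j.
  have i0 : (0 < i)%N by lia.
  apply: (main (i.-1, j)); last 1 first.
  - rewrite jsq_rateE /= i0 j0 /= eqxx mulr1.
    by apply: rate; rewrite ?mulr_ge0 ?arrival1_ge0 ?arrival2_ge0 ?lexx.
  - by move: ijn; rewrite !mem_boxseq/=; lia.
  - by move=> /=; lia.
apply: (main (i, j.-1)); last 1 first.
- rewrite jsq_rateE /= j0 eqxx mulr1.
  by apply: rate; rewrite ?mulr_ge0 ?arrival1_ge0 ?arrival2_ge0 ?lexx ?orbT.
- by move: ijn; rewrite !mem_boxseq/=; lia.
- by move=> /=; lia.
Qed.

(** The left side is the generator applied to i^2 + j^2. Arrivals join the shorter queue, whose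
    length is at most (i + j) / 2, so they contribute at most 2 rho (i + j) + 2 rho. Departures
    contribute at most 2 - 2 (i + j), the constant also covering empty queues. *)
Lemma lyapunov_drift room (x : nat * nat) :
  arrival1 rho room x * (x.1.*2.+1)%:R + arrival2 rho room x * (x.2.*2.+1)%:R
  - (0 < x.1)%:R * (x.1.*2%:R - 1) - (0 < x.2)%:R * (x.2.*2%:R - 1)
  <= 4 - 2 * (1 - rho) * (x.1 + x.2)%:R.
Proof.
have dblS k : k.*2.+1%:R = k%:R * 2 + 1 :> R by rewrite -natr1 -muln2 natrM.
have dbl k : k.*2%:R = k%:R * 2 :> R by rewrite -muln2 natrM.
case: x => i j; rewrite /arrival1 /arrival2 /= !dblS !dbl natrD {dblS dbl}.
have dep k : k%:R * 2 - 1 <= (0 < k)%:R * (k%:R * 2 - 1) :> R.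
  by case: k => [|k]; rewrite ?mul0r ?mul1r//=; lra.
have := dep i; have := dep j.
move: ((0 < i)%:R * _) ((0 < j)%:R * _) => di dj hj hi.
have i0 : 0 <= i%:R :> R by [].
have j0 : 0 <= j%:R :> R by [].
case: ltngtP => [ij|ij|ij].
- have : rho * (i%:R : R) <= rho * j%:R.
    by rewrite ler_wpM2l ?(ltW rho0)// ler_nat ltnW.
  by move: hi hj rho0 rho1; lra.
- have : rho * (j%:R : R) <= rho * i%:R.
    by rewrite ler_wpM2l ?(ltW rho0)// ler_nat ltnW.
  by move: hi hj rho0 rho1; lra.
- have ? : 0 <= rho * (i%:R : R) by rewrite mulr_ge0 ?(ltW rho0).
  have ij' : i%:R = j%:R :> R by rewrite ij.
  rewrite -ij' in hj *.
  by case: (room i); move: hi hj rho0 rho1; rewrite /=; lra.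
Qed.

Definition sqnorm (x : nat * nat) : R := (x.1 ^ 2 + x.2 ^ 2)%:R.

Lemma lyapunov_generator K x : x \in boxseq K ->
  \sum_(z <- boxseq K) jsq_rate rho (below K) x z * (sqnorm z - sqnorm x) <=
  4 - 2 * (1 - rho) * (x.1 + x.2)%:R.
Proof.
move=> xK; rewrite sum_jsq_rate_finite//.
apply: le_trans (lyapunov_drift (below K) x).
have up a b : (a.+1 ^ 2 + b)%:R - (a ^ 2 + b)%:R = (a.*2.+1)%:R :> R.
  by apply/eqP; rewrite subr_eq -natrD eqr_nat; apply/eqP; lia.
have dn a b : (0 < a)%N%:R * ((a.-1 ^ 2 + b)%:R - (a ^ 2 + b)%:R) =
     - ((0 < a)%N%:R * (a.*2%:R - 1)) :> R.
  case: a => [|a]; rewrite ?mul0r ?oppr0// !mul1r/=.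
  by rewrite doubleS -[in RHS]natr1 -(up a b); ring.
case: x xK => i j xK; rewrite /sqnorm /= up dn.
by rewrite ![(i ^ 2 + _)%N]addnC up dn.
Qed.

Variables (K : nat) (p : nat * nat -> R).
Hypothesis p0 : forall x, 0 <= p x.
Hypothesis p1 : \sum_(x <- boxseq K) p x = 1.
Hypothesis balance : forall y, y \in boxseq K ->
  p y * jsq_out rho (below K) y =
  \sum_(x <- boxseq K) p x * jsq_rate rho (below K) x y.

(** Under the invariant law the generator of [sqnorm] has mean 0, so the drift bound gives 0 <= 4 -
    2 (1 - rho) E[i + j]. *)
Lemma finite_moment : \sum_(x <- boxseq K) p x * (x.1 + x.2)%:R <= 2 / (1 - rho).
Proof.
pose drift x :=
  \sum_(z <- boxseq K) jsq_rate rho (below K) x z * (sqnorm z - sqnorm x).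
have drift0 : \sum_(x <- boxseq K) p x * drift x = 0.
  (* Exchanging the sums writes the mean drift as total inflow minus total outflow, both weighted by
     [sqnorm]; these agree state by state by [balance]. *)
  rewrite [LHS](_ : _ = \sum_(z <- boxseq K) (\sum_(x <- boxseq K)
      p x * jsq_rate rho (below K) x z) * sqnorm z -
      \sum_(x <- boxseq K) p x * jsq_out rho (below K) x * sqnorm x); last first.
    under [X in _ = X - _]eq_bigr do rewrite mulr_suml.
    rewrite exchange_big/= -sumrB big_seq [RHS]big_seq; apply: eq_bigr => x xK.
    rewrite -sum_jsq_rate_finite_out// mulr_sumr -mulrA mulr_suml mulr_sumr -sumrB.
    by apply: eq_bigr => z _; ring.
  rewrite -sumrB big_seq big1// => x xK.
  by rewrite balance// subrr.
have : 0 <= \sum_(x <- boxseq K) p x * (4 - 2 * (1 - rho) * (x.1 + x.2)%:R).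
  rewrite -[leLHS]drift0 big_seq [leRHS]big_seq; apply: ler_sum => x xK.
  by rewrite ler_wpM2l// lyapunov_generator.
have -> : \sum_(x <- boxseq K) p x * (4 - 2 * (1 - rho) * (x.1 + x.2)%:R) =
  4 * (\sum_(x <- boxseq K) p x) -
  2 * (1 - rho) * \sum_(x <- boxseq K) p x * (x.1 + x.2)%:R.
  by rewrite !mulr_sumr -sumrB; apply: eq_bigr => x _; ring.
rewrite p1 ler_pdivlMr ?subr_gt0//; lra.
Qed.

(** Markov's inequality for i + j, which is at least N + 1 outside the box of size [N]. The bound is
    uniform in [K]. *)
Lemma finite_tail N : (N <= K)%N ->
  1 - 2 / (1 - rho) / N.+1%:R <= \sum_(x <- boxseq N) p x.
Proof.
move=> NK.
have split (F : nat * nat -> R) : \sum_(x <- boxseq K) F x =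
    \sum_(x <- boxseq N) F x +
    \sum_(x <- boxseq K | x \notin boxseq N) F x.
  rewrite (bigID [in boxseq N])/= -big_filter; congr (_ + _); apply: perm_big.
  rewrite uniq_perm ?filter_uniq ?boxseq_uniq// => y.
  by rewrite mem_filter andb_idr//; exact: boxseq_sub.
rewrite -[X in X - _ <= _]p1 split lerBlDr lerD2l ler_pdivlMr ?ltr0n//.
apply: le_trans finite_moment.
rewrite split mulr_suml ler_wpDl ?sumr_ge0// => [x _|].
  by rewrite mulr_ge0.
apply: ler_sum => x xN; rewrite ler_wpM2l// ler_nat.
by case: x xN => i j; rewrite mem_boxseq/=; lia.
Qed.

(** The corner alone contributes 2 K p(K, K) to the mean of i + j. *)
Lemma finite_corner : p (K, K) * K%:R <= 1 / (1 - rho).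
Proof.
have := finite_moment; rewrite (bigD1_seq (K, K)) ?boxseq_uniq//=; last first.
  by rewrite mem_boxseq/= leqnn.
have : 0 <= \sum_(i <- boxseq K | i != (K, K)) p i * (i.1 + i.2)%:R.
  by apply: sumr_ge0 => x _; rewrite mulr_ge0.
rewrite natrD; move: (\sum_(_ <- _ | _) _) => S S0.
rewrite !ler_pdivlMr ?subr_gt0//.
have : 0 <= S * (1 - rho) by rewrite mulr_ge0// subr_ge0 ltW.
lra.
Qed.

Hypothesis p_out : forall x, x \notin boxseq K -> p x = 0.

(** Removing the capacity changes rates at the corner only. The constant is 4 + 4: the change of the
    exit rate there is at most 4, and so is the sum of the rates out of the corner. The box of size
    K + 1 includes the targets of the arrivals that were blocked. *)
Lemma infinite_balance_defect :
  \sum_(y <- boxseq K.+1) `|p y * jsq_out rho xpredT y -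
     \sum_(x <- boxseq K) p x * jsq_rate rho xpredT x y| <= 8 * p (K, K).
Proof.
have KK : (K, K) \in boxseq K by rewrite mem_boxseq /= leqnn.
have bal y : p y * jsq_out rho (below K) y =
    \sum_(x <- boxseq K) p x * jsq_rate rho (below K) x y.
  have [yK|yK] := boolP (y \in boxseq K); first exact: balance.
  rewrite p_out// mul0r big1_seq// => x /andP[_ xK].
  by rewrite jsq_rate_finite_closed ?mulr0.
have bound y : `|p y * jsq_out rho xpredT y -
     \sum_(x <- boxseq K) p x * jsq_rate rho xpredT x y| <=
   (y == (K, K))%:R * (4 * p (K, K)) + p (K, K) * jsq_rate rho xpredT (K, K) y.
  have -> : p y * jsq_out rho xpredT y -
     \sum_(x <- boxseq K) p x * jsq_rate rho xpredT x y =
     p y * (jsq_out rho xpredT y - jsq_out rho (below K) y) -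
     \sum_(x <- boxseq K)
       p x * (jsq_rate rho xpredT x y - jsq_rate rho (below K) x y).
    rewrite mulrBr bal; under [X in _ = _ - X]eq_bigr do rewrite mulrBr.
    by rewrite sumrB; ring.
  rewrite (le_trans (ler_normB _ _))// lerD//.
    have [->|yKK] := eqVneq y (K, K); last first.
      have [yK|yK] := boolP (y \in boxseq K).
        by rewrite jsq_out_finite_eq// subrr mulr0 normr0 mul0r.
      by rewrite p_out// !mul0r normr0.
    rewrite mul1r ger0_norm; last by rewrite mulr_ge0// subr_ge0 jsq_out_finite_le.
    rewrite mulrC ler_wpM2r// (le_trans _ (jsq_out_le4 rho0 rho1 xpredT (K, K)))//.
    rewrite gerBl /jsq_out !addr_ge0 ?arrival1_ge0 ?arrival2_ge0//.
  rewrite (bigD1_seq (K, K)) ?boxseq_uniq//= big1_seq ?addr0; last first.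
    by move=> x /andP[xKK xK]; rewrite jsq_rate_finite_eq// subrr mulr0.
  rewrite ger0_norm; last by rewrite mulr_ge0// subr_ge0 jsq_rate_finite_le.
  by rewrite ler_wpM2l// gerBl jsq_rate_ge0.
apply: le_trans (ler_sum _ (fun y _ => bound y)) _.
rewrite big_split/= sumr_delta ?boxseq_uniq// -mulr_sumr.
rewrite (boxseq_sub (leqnSn K) KK) mul1r.
have : p (K, K) * \sum_(y <- boxseq K.+1) jsq_rate rho xpredT (K, K) y <=
    p (K, K) * 4.
  rewrite ler_wpM2l// (le_trans (sum_jsq_rate_le_out rho0 _ _ (boxseq_uniq _)))//.
  exact: jsq_out_le4.
lra.
Qed.
End drift.

(** * Point masses of probabilities on pairs of naturals *)

Lemma esum_seq (R : realType) (T : choiceType) (A : set T) (s : seq T) (f : T -> R) :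
  uniq s -> (forall x, 0 <= f x) ->
  (forall x, A x -> x \notin s -> f x = 0) ->
  (forall x, x \in s -> ~ A x -> f x = 0) ->
  (\esum_(x in A) (f x)%:E = (\sum_(x <- s) f x)%:E)%E.
Proof.
move=> us f0 As sA.
rewrite -sumEFin fsbig_seq// -esum_fset => [|//|x _]; last by rewrite lee_fin.
rewrite esum_mkcond [RHS]esum_mkcond; apply: eq_esum => x _.
case: ifPn; rewrite ?inE ?notin_setE /= => xA;
  case: ifPn; rewrite ?inE ?notin_setE /= => xs //.
  by rewrite As//; apply/negP.
by rewrite sA.
Qed.

Section mass.
Variable R : realType.

Lemma measurable_nat_pair (A : set (nat * nat)) : measurable A.
Proof.
apply: countable_measurable; last exact: countableP.
move=> [i j]; rewrite (_ : [set (i, j)] = [set i] `*` [set j]); last first.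
  by apply/seteqP; split => [x -> //|[a b] [/= -> ->]].
exact: measurableX.
Qed.
Local Hint Resolve measurable_nat_pair : core.

Definition mass (P : probability (nat * nat)%type R) (x : nat * nat) : R :=
  fine (P [set x]).

Variable P : probability (nat * nat)%type R.

Lemma massE x : P [set x] = (mass P x)%:E.
Proof. by rewrite /mass fineK// fin_num_measure. Qed.

Lemma mass_ge0 x : 0 <= mass P x.
Proof. exact: fine_ge0. Qed.

Lemma Rintegral_seq (s : seq (nat * nat)) (f : nat * nat -> R) : uniq s ->
  P.-integrable setT (EFin \o f) ->
  \int[P]_(x in [set` s]) f x = \sum_(x <- s) f x * mass P x.
Proof.
move=> + intf; elim: s => [_|x s IH /= /andP[xs us]].
  by rewrite set_nil Rintegral_set0 big_nil.
have -> : [set` x :: s] = [set x] `|` [set` s].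
  by apply/seteqP; split => y /=; rewrite inE => /predU1P.
rewrite big_cons -IH// Rintegral_setU//; first last.
- by apply/disj_set2P; apply/seteqP; split => // y [/= -> ys]; rewrite ys in xs.
- exact: integrableS intf.
congr (_ + _).
rewrite (@eq_Rintegral _ _ _ _ _ (cst (f x))) ?Rintegral_cst//.
by move=> y; rewrite inE => /= ->.
Qed.

Lemma integrable_bounded (f : nat * nat -> R) M : (forall x, `|f x| <= M) ->
  P.-integrable setT (EFin \o f).
Proof.
move=> fM; apply: measurable_bounded_integrable.
- exact: measurableT.
- exact: le_lt_trans (probability_le1 P (measurable_nat_pair _)) (ltry 1).
- by move=> _ Y _; exact: measurable_nat_pair.
by exists M; split; [exact: num_real|move=> N MN x _; exact: le_trans (ltW MN)].
Qed.

Lemma probability_seq (s : seq (nat * nat)) : uniq s ->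
  fine (P [set` s]) = \sum_(x <- s) mass P x.
Proof.
move=> us; have := @Rintegral_seq s (cst 1) us.
rewrite Rintegral_cst// mul1r => ->.
  by apply: eq_bigr => x _; rewrite mul1r.
by apply: (@integrable_bounded _ 1) => x; rewrite normr1.
Qed.

Lemma sum_mass_le1 (s : seq (nat * nat)) : uniq s -> \sum_(x <- s) mass P x <= 1.
Proof.
move=> us; rewrite -probability_seq// -lee_fin fineK ?fin_num_measure//.
exact: probability_le1.
Qed.

(** The error is the integral of [f] over the complement of [s], whose probability is the last
    factor. *)
Lemma Rintegral_seq_approx (s : seq (nat * nat)) (f : nat * nat -> R) M :
  uniq s -> (forall x, `|f x| <= M) ->
  `|\int[P]_x f x - \sum_(x <- s) f x * mass P x| <=
    M * (1 - \sum_(x <- s) mass P x).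
Proof.
move=> us fM; have intf := integrable_bounded fM.
rewrite -(setUv [set` s]) Rintegral_setU ?setUv//; last exact/disj_set2P/setICr.
rewrite Rintegral_seq// addrAC subrr add0r.
apply: le_trans (le_normr_Rintegral _ _) _ => //; first exact: integrableS intf.
apply: (@le_trans _ _ (\int[P]_(x in ~` [set` s]) (cst M) x)).
  apply: le_Rintegral => //.
  - apply: (integrableS _ _ _ (@integrable_bounded (fun x => `|f x|) M _)) => //.
    by move=> x; rewrite normr_id.
  - by apply: (integrableS _ _ _ (@integrable_bounded (cst M) `|M| _)).
rewrite Rintegral_cst//.
have /= -> := probability_setC P (measurable_nat_pair [set` s]).
by rewrite fineB ?fin_num_measure// probability_seq.
Qed.

Lemma boxseqE n : [set` boxseq n] = box n.
Proof. by apply/seteqP; split => x; rewrite /box/= mem_boxseq => /andP. Qed.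

Lemma sum_mass_boxseq_cvg : \sum_(x <- boxseq n) mass P x @[n --> \oo] --> (1 : R).
Proof.
under eq_fun do rewrite -probability_seq ?boxseq_uniq//.
have UT : \bigcup_n [set` boxseq n] = setT.
  apply/seteqP; split => // x _; exists (maxn x.1 x.2) => //=.
  by rewrite mem_boxseq leq_maxl leq_maxr.
have h : P \o (fun n => [set` boxseq n]) @ \oo --> P (\bigcup_n [set` boxseq n]).
  apply: nondecreasing_cvg_mu => // m n mn; rewrite subsetEset => x /=.
  exact: boxseq_sub.
apply: fine_cvg; rewrite UT probability_setT in h; exact: h.
Qed.

End mass.

(** * Balance equations for the point masses *)

Section invariance.
Variables (R : realType) (rho : R) (P : probability (nat * nat)%type R).
Hypothesis rho0 : 0 < rho.

(** A jump moves each coordinate by at most one, so no jump in either direction links the box of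
    size [n] to the outside of the box of size n + 1: both infinite sums become finite. *)
Lemma jsq_infinite_balance n y : jsq_infinite_invariant rho P -> y \in boxseq n ->
  mass P y * jsq_out rho xpredT y =
  \sum_(x <- boxseq n.+1) mass P x * jsq_rate rho xpredT x y.
Proof.
move=> [_ /(_ y Logic.I)] + yn.
have near x z : x \in boxseq n -> z \notin boxseq n.+1 ->
    jsq_rate rho xpredT x z = 0 /\ jsq_rate rho xpredT z x = 0.
  case: x z => [i j] [a b]; rewrite !mem_boxseq /= => ij ab.
  rewrite !jsq_rateE/= !xpair_eqE.
  have F (u v : bool) : ~~ (u && v) -> (u && v)%:R = 0 :> R by move=> /negPf ->.
  by split; rewrite !F ?mulr0 ?addr0//; lia.
rewrite massE (@esum_seq _ _ _ (boxseq n.+1)) ?boxseq_uniq//; first last.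
- by move=> z _ /(_ Logic.I).
- by move=> z _ /(near _ _ yn) -[].
- by move=> z; exact: jsq_rate_ge0.
rewrite (_ : \esum_(x in _) _ =
  \esum_(x in setT) (mass P x * jsq_rate rho xpredT x y)%:E)%E; last first.
  by apply: eq_esum => x _; rewrite massE.
rewrite (@esum_seq _ _ _ (boxseq n.+1)) ?boxseq_uniq//; first last.
- by move=> z _ /(_ Logic.I).
- by move=> z _ /(near _ _ yn) -[_ ->]; rewrite mulr0.
- by move=> z; rewrite mulr_ge0 ?jsq_rate_ge0// mass_ge0.
by rewrite -EFinM => -[]; rewrite sum_jsq_rate_interior_out.
Qed.

Variable K : nat.
Hypothesis inv : jsq_finite_invariant rho K P.

Lemma jsq_finite_mass_out x : x \notin boxseq K -> mass P x = 0.
Proof.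
move=> xK; apply/eqP; rewrite -eqe -massE -measure_le0.
case: inv => <- _; apply: le_measure; rewrite ?inE//; try exact: measurable_nat_pair.
by move=> _ ->; rewrite -boxseqE /=; exact/negP.
Qed.

Lemma jsq_finite_mass_sum : \sum_(x <- boxseq K) mass P x = 1.
Proof.
rewrite -probability_seq ?boxseq_uniq// boxseqE.
have /= := probability_setC P (measurable_nat_pair (box K)); rewrite (proj1 inv).
rewrite -[P (box K)]fineK ?fin_num_measure//; last exact: measurable_nat_pair.
by rewrite -EFinB => -[] /esym/eqP; rewrite subr_eq0 => /eqP.
Qed.

Lemma jsq_finite_balance y : y \in boxseq K ->
  mass P y * jsq_out rho (below K) y =
  \sum_(x <- boxseq K) mass P x * jsq_rate rho (below K) x y.
Proof.
move=> yK; case: inv => _ /(_ y); rewrite -boxseqE => /(_ yK).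
rewrite massE (@esum_seq _ _ _ (boxseq K)) ?boxseq_uniq//; first last.
- by move=> z /= ->.
- by move=> z; exact: jsq_rate_ge0.
rewrite (_ : \esum_(x in _) (P _ * _) =
  \esum_(x in [set` boxseq K]) (mass P x * jsq_rate rho (below K) x y)%:E)%E;
  last first.
  by apply: eq_esum => x _; rewrite massE.
rewrite (@esum_seq _ _ _ (boxseq K)) ?boxseq_uniq//; first last.
- by move=> z /= ->.
- by move=> z; rewrite mulr_ge0 ?jsq_rate_ge0// mass_ge0.
by rewrite -EFinM => -[]; rewrite sum_jsq_rate_finite_out.
Qed.

End invariance.

(** * From one-sided bounds to total variation *)

Lemma sum_dist_le_one_sided (R : realDomainType) (T : eqType) (s : seq T)
    (u v : T -> R) (delta eta : R) :
  0 <= delta -> (forall x, x \in s -> u x - v x <= delta) ->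
  \sum_(x <- s) v x <= 1 -> 1 - eta <= \sum_(x <- s) u x ->
  \sum_(x <- s) `|u x - v x| <= 2 * (size s)%:R * delta + eta.
Proof.
move=> delta0 uv v1 u1.
(* If t <= delta and 0 <= delta, then |t| <= 2 delta - t. Summing, the linear terms give the
   difference of the masses of [v] and [u], at most [eta]. *)
have : \sum_(x <- s) `|u x - v x| <= \sum_(x <- s) (2 * delta - (u x - v x)).
  rewrite big_seq [leRHS]big_seq; apply: ler_sum => x /uv uvx.
  by rewrite ler_norml; apply/andP; split; lra.
rewrite !sumrB big_const_seq count_predT iter_addr_0 -[_ *+ _]mulr_natr.
move: u1 v1; lra.
Qed.

Section comparison.
Variables (R : realType) (rho : R) (K : nat) (P' P : probability (nat * nat)%type R).
Hypotheses (rho0 : 0 < rho) (rho1 : rho < 1).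
Hypothesis inv' : jsq_finite_invariant rho K P'.
Hypothesis inv : jsq_infinite_invariant rho P.

Lemma jsq_one_sided :
  (forall x, x \in boxseq K ->
     mass P' x - mass P x <= 5 ^+ (x.1 + x.2) * (8 * mass P' (K, K))) \/
  (forall x, x \in boxseq K ->
     mass P x - mass P' x <= 5 ^+ (x.1 + x.2) * (8 * mass P' (K, K))).
Proof.
pose d x := mass P' x - mass P x.
pose w := jsq_out rho xpredT.
pose q := jsq_rate rho xpredT.
pose E := 8 * mass P' (K, K).
(* The defect lives on the box of size K + 1, and the predecessors of its states need one more
   layer. *)
pose s := boxseq K.+2.
(* On this box the infinite law is exactly balanced, so the defect of [d] is that of the finite
   law. *)
have eE : \sum_(z <- boxseq K.+1) `|d z * w z - \sum_(y <- s) d y * q y z| <= E.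
  apply: le_trans (infinite_balance_defect rho0 rho1 (mass_ge0 P')
    (jsq_finite_balance rho0 inv') (jsq_finite_mass_out inv')).
  rewrite big_seq [leRHS]big_seq; apply: ler_sum => z zK.
  rewrite le_eqVlt; apply/orP; left; apply/eqP.
  congr (`| _ |); rewrite /d; under eq_bigr do rewrite mulrBl.
  rewrite mulrBl sumrB (jsq_infinite_balance rho0 inv zK) -/q -/w -/s.
  suff -> : \sum_(y <- s) mass P' y * q y z =
    \sum_(y <- boxseq K) mass P' y * q y z by ring.
  rewrite (bigID [in boxseq K])/= [X in _ + X]big1 ?addr0; last first.
    by move=> y yK; rewrite (jsq_finite_mass_out inv' yK) mul0r.
  rewrite -big_filter; apply: perm_big.
  rewrite uniq_perm ?filter_uniq ?boxseq_uniq// => y.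
  by rewrite mem_filter andb_idr// => /(boxseq_sub (leqW (leqnSn K))).
have sub : {subset boxseq K.+1 <= s} by apply: boxseq_sub.
have dout x : x \in s -> x \notin boxseq K.+1 -> d x <= 0.
  move=> _ xK; rewrite /d (jsq_finite_mass_out inv') ?sub0r ?oppr_le0 ?mass_ge0//.
  by apply: contra xK; exact: boxseq_sub.
have qw x : \sum_(z <- boxseq K.+1) q x z <= w x.
  exact/sum_jsq_rate_le_out/boxseq_uniq.
have q0 x y : 0 <= q x y by exact: jsq_rate_ge0.
have E0 : 0 <= E by rewrite mulr_ge0// mass_ge0.
have max0 (f : nat * nat -> R) x : 0 <= Num.max (f x) 0 by rewrite le_max lexx orbT.
have maxl (f : nat * nat -> R) x : f x <= Num.max (f x) 0 by rewrite le_max lexx.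
have Ksub := boxseq_sub (leqnSn K).
have [d0|d0] := leP (d (0, 0)%N) 0; [left|right] => x xK.
  apply: le_trans (maxl d x) _.
  apply: (departure_propagation rho0 rho1 E0 (max0 d) _ _ (Ksub _ xK)).
    exact: max_r.
  move=> y yK; have := inflow_posr_part_le sub
    (boxseq_uniq _) (boxseq_uniq _) q0 qw dout yK.
  move=> h; rewrite -(lerD2r `|d y * w y - \sum_(z <- s) d z * q z y|).
  apply: le_trans h _.
  by rewrite -addrA lerD2l (le_trans eE)// lerDl.
rewrite -opprB -/(d x); apply: le_trans (maxl (fun x => - d x) x) _.
apply: (departure_propagation rho0 rho1 E0 (max0 (fun x => - d x)) _ _ (Ksub _ xK)).
  by apply: max_r; rewrite oppr_le0 ltW.
move=> y yK; apply: le_trans (inflow_negr_part_le sub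
  (boxseq_uniq _) (boxseq_uniq _) q0 qw dout yK) _.
by rewrite lerD2l.
Qed.

(** Since [harmonic K] is 1 / (K + 1), the corner bound, which is void at K = 0, is combined with
    p(K, K) <= 1: the sum 1 + (1 - rho) is at most 2. *)
Lemma finite_corner_harmonic : mass P' (K, K) <= 2 / (1 - rho) * harmonic K.
Proof.
have r1 : 0 < 1 - rho by rewrite subr_gt0.
have := finite_corner rho0 rho1 (mass_ge0 P') (jsq_finite_mass_sum inv')
  (jsq_finite_balance rho0 inv').
have c1 : mass P' (K, K) <= 1.
  by have := sum_mass_le1 P' (s := [:: (K, K)]) isT; rewrite big_seq1.
rewrite /harmonic /= ler_pdivlMr ?ltr0n// -[K.+1%:R]natr1 !ler_pdivlMr// => h.
apply: (@le_trans _ _ (1 + (1 - rho))); last by move: rho0; lra.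
by rewrite mulrAC mulrDr mulr1 mulrAC lerD// ler_piMl// ltW.
Qed.

(** Truncating both integrals to the box of size [N] costs [M] times each tail; on the box the cost
    is [M] times the total variation, which contains both tails once more. For fixed [N] the last
    term vanishes as [K] grows. *)
Lemma jsq_integral_dist (f : nat * nat -> R) (M : R) N : (N <= K)%N ->
  (forall x, `|f x| <= M) ->
  `|\int[P]_x f x - \int[P']_x f x| <=
    2 * M * ((1 - \sum_(x <- boxseq N) mass P x) + 2 / (1 - rho) * harmonic N) +
    M * (2 * (size (boxseq N))%:R * (5 ^+ (N + N) * (8 * (2 / (1 - rho)))))
      * harmonic K.
Proof.
move=> NK fM.
set tP := 1 - \sum_(x <- boxseq N) mass P x; set tK := 2 / (1 - rho) * harmonic N.
have M0 : 0 <= M by apply: le_trans (fM (0, 0)%N).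
have tP0 : 0 <= tP by rewrite subr_ge0 sum_mass_le1 ?boxseq_uniq.
have r1 : 0 < 1 - rho by rewrite subr_gt0.
have tK0 : 0 <= tK by rewrite mulr_ge0 ?divr_ge0 ?(ltW r1) ?harmonic_ge0.
have tail' : 1 - tK <= \sum_(x <- boxseq N) mass P' x.
  exact: (finite_tail rho0 rho1 (mass_ge0 P') (jsq_finite_mass_sum inv')
    (jsq_finite_balance rho0 inv') NK).
set delta := 5 ^+ (N + N) * (8 * (2 / (1 - rho) * harmonic K)).
have delta_ge x : x \in boxseq N ->
    5 ^+ (x.1 + x.2) * (8 * mass P' (K, K)) <= delta.
  rewrite mem_boxseq => /andP[x1 x2]; apply: ler_pM.
  - by rewrite exprn_ge0.
  - by rewrite mulr_ge0// mass_ge0.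
  - by rewrite ler_weXn2l// ?ler1n// leq_add.
  - by rewrite ler_wpM2l// finite_corner_harmonic.
have delta0 : 0 <= delta.
  have := delta_ge (0, 0)%N; rewrite mem_boxseq => /(_ isT); apply: le_trans.
  by rewrite !mulr_ge0// mass_ge0.
(* In the one-sided estimate [u] is the finite law with tail [tK] or the infinite law with tail
   [tP]; the sum of the tails serves both cases. *)
have tv : \sum_(x <- boxseq N) `|mass P x - mass P' x| <=
    2 * (size (boxseq N))%:R * delta + (tP + tK).
  have sub := boxseq_sub NK.
  case: jsq_one_sided => one_sided.
    under eq_bigr do rewrite distrC.
    apply: sum_dist_le_one_sided => //; last by move: tail' tP0; lra.
      by move=> x xN; apply: le_trans (one_sided _ (sub _ xN)) (delta_ge _ xN).
    by rewrite sum_mass_le1 ?boxseq_uniq.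
  apply: sum_dist_le_one_sided => //; last by rewrite /tP; move: tK0; lra.
    by move=> x xN; apply: le_trans (one_sided _ (sub _ xN)) (delta_ge _ xN).
  by rewrite sum_mass_le1 ?boxseq_uniq.
have A := Rintegral_seq_approx P (boxseq_uniq N) fM.
have A' := Rintegral_seq_approx P' (boxseq_uniq N) fM.
have B : `|\sum_(x <- boxseq N) f x * mass P x -
      \sum_(x <- boxseq N) f x * mass P' x|
    <= M * \sum_(x <- boxseq N) `|mass P x - mass P' x|.
  rewrite -sumrB mulr_sumr; apply: le_trans (ler_norm_sum _ _ _) _.
  by apply: ler_sum => x _; rewrite -mulrBr normrM ler_wpM2r.
have C := ler_wpM2l M0 tv.
have D : M * (1 - \sum_(x <- boxseq N) mass P' x) <= M * tK.
  by rewrite ler_wpM2l//; move: tail'; lra.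
have -> : 2 * M * (tP + tK) + M * (2 * (size (boxseq N))%:R *
   (5 ^+ (N + N) * (8 * (2 / (1 - rho))))) * harmonic K =
  M * tP + (M * (2 * (size (boxseq N))%:R * delta + (tP + tK)) + M * tK).
  by rewrite /delta; ring.
rewrite distrC in A'.
apply: le_trans (lerD A (lerD (le_trans B C) (le_trans A' D))).
set I := \int[P]_x _; set S := \sum_(_ <- _) _ in A *.
set S' := \sum_(_ <- _) _ in A' *.
have -> : I - \int[P']_x f x = (I - S) + ((S - S') + (S' - \int[P']_x f x)) by ring.
by rewrite (le_trans (ler_normD _ _))// lerD2l ler_normD.
Qed.
End comparison.

(** * Passage to the limit *)

Theorem corollary1 (R : realType) (rho : R) (hrho0 : 0 < rho) (hrho1 : rho < 1)
    (piK : nat -> probability (nat * nat)%type R)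
    (pi : probability (nat * nat)%type R)
    (hpiK : forall K : nat, jsq_finite_invariant rho K (piK K))
    (hpi : jsq_infinite_invariant rho pi) :
  weakly_converges piK pi.
Proof.
(* Boundedness provides a bound by every real strictly above [B], hence the choice B + 1. *)
move=> f _ [B [_ fB]]; pose M := B + 1.
have fM x : `|f x| <= M by apply: fB; rewrite ?ltrDl.
have tail_cvg0 : 2 * M * ((1 - \sum_(x <- boxseq N) mass pi x) +
    2 / (1 - rho) * harmonic N) @[N --> \oo] --> (0 : R).
  rewrite [X in _ --> X](_ : _ = 2 * M * ((1 - 1) + 2 / (1 - rho) * 0));
    last by ring.
  apply: cvgMl_tmp; apply: cvgD; last by apply: cvgMl_tmp; exact: cvg_harmonic.
  by apply: cvgB; [exact: cvg_cst|exact: sum_mass_boxseq_cvg].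
apply/cvgrPdist_le => e e0.
have e20 : 0 < e / 2 by rewrite divr_gt0.
(* First [N] is fixed so that the tails cost at most e / 2; the constant [c] then depends on [N] but
   not on [K], and [K] is taken large. *)
have /cvgrPdist_le /(_ _ e20) [N _ /(_ N (leqnn N))/=] := tail_cvg0.
rewrite sub0r normrN => tailN.
set c := M * (2 * (size (boxseq N))%:R * (5 ^+ (N + N) * (8 * (2 / (1 - rho))))).
have corner_cvg0 : c * harmonic K @[K --> \oo] --> (0 : R).
  by rewrite -[X in _ --> X](mulr0 c); apply: cvgMl_tmp; exact: cvg_harmonic.
near=> K.
have NK : (N <= K)%N by near: K; exact: nbhs_infty_ge.
apply: le_trans (jsq_integral_dist hrho0 hrho1 (hpiK K) hpi NK fM) _.
rewrite [leRHS]splitr lerD// (le_trans (ler_norm _))//.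
rewrite -normrN -[- _]sub0r; near: K.
by move/cvgrPdist_le: corner_cvg0; apply.
Unshelve. all: by end_near.
Qed.
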